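(* Let $k,m\ge1$ be integers. If the Quasifree Conjecture is true for $k$ and $m$, then for all $n\ge m$, $$h_{k,n}(q)_{\le m}=\left(\frac{1}{(1-q)^{k(n-m)}}\,h_{k,m}(q)\right)_{\le m}.$$
   Context: For $k,n\ge1$, $\mathcal{R}^{k,n}=\mathbb{C}[x_{i,j}:1\le i\le k,1\le j\le n]$, graded by total degree, with $S_n$ acting by $s\cdot x_{i,j}=x_{i,s(j)}$. $\mathcal{I}^{k,n}=(\mathcal{R}^{k,n})^{S_n}$, $\mathcal{I}^{k,n}_+$ is the space of invariants with zero constant term, and $(\mathcal{I}^{k,n}_+)$ is the ideal of $\mathcal{R}^{k,n}$ it generates. For $\alpha\in\mathbb{Z}_{\ge0}^k$, $|\alpha|=\sum\alpha_i$ and $p_{\alpha,n}=\sum_{j=1}^n x_{1,j}^{\alpha_1}\cdots x_{k,j}^{\alpha_k}$. $h_{k,n}(q)=\sum_{j\ge0}q^j\dim\big(\mathcal{R}^{k,n}/(\mathcal{I}^{k,n}_+)\big)_j$ is the Hilbert series of the coinvariants. For a power series $u(q)=\sum u_iq^i$, $u(q)_{\le m}=\sum_{i=0}^m u_iq^i$. Order $\mathbb{Z}_{\ge0}^k$ lexicographically. The Quasifree Conjecture for $k$ and $m$ is the following statement. Let $V^{k,m}$ be a graded subspace of $\mathcal{R}^{k,m}$ which the projection $\mathcal{R}^{k,m}\to\mathcal{R}^{k,m}/(\mathcal{I}^{k,m}_+)$ maps bijectively onto the quotient. For each sequence $\alpha^1\le\cdots\le\alpha^r$ ($r\ge0$)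 of nonzero vectors in $\mathbb{Z}_{\ge0}^k$ with $d=\sum_i|\alpha^i|\le m$, let $v_{\alpha^1,\dots,\alpha^r}\in V^{k,m}$ have all its components in degrees $\le m-d$. If $\sum_{\alpha^1\le\cdots\le\alpha^r}v_{\alpha^1,\dots,\alpha^r}\,p_{\alpha^1,m}\cdots p_{\alpha^r,m}=0$, then all $v_{\alpha^1,\dots,\alpha^r}=0$. *)

(* Defs.v *)
From HB Require Import structures.
From mathcomp Require Import all_boot all_order all_algebra all_fingroup.
From mathcomp Require Import all_classical reals.
From mathcomp Require Import mpoly complex.

Set Implicit Arguments.
Unset Strict Implicit.
Unset Printing Implicit Defensive.

Import Order.TTheory GRing.Theory Num.Theory.
Local Open Scope classical_set_scope.
Local Open Scope ring_scope.

Definition subspace (F : fieldType) (E : lmodType F) (V : set E) : Prop :=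
  [/\ V 0, forall x y, V x -> V y -> V (x + y)
         & forall (c : F) x, V x -> V (c *: x)].

(* The classes of b_0, ..., b_(d-1) form a basis of the image of V in E/W. *)
Definition basis_mod (F : fieldType) (E : lmodType F) (V W : set E)
    (d : nat) (b : 'I_d -> E) : Prop :=
  [/\ forall i, V (b i),
      forall c : 'I_d -> F, W (\sum_(i < d) c i *: b i) -> forall i, c i = 0
    & forall x, V x -> exists c : 'I_d -> F, W (x - \sum_(i < d) c i *: b i)].

(* Dimension of the image of V in E/W.  The value is 0 by convention when that
   image is infinite-dimensional, which does not happen below: see hilbP. *)
Definition dim_mod (F : fieldType) (E : lmodType F) (V W : set E) : nat :=
  xget 0%N [set d | exists b : 'I_d -> E, basis_mod V W b].

(* The restriction to V of the projection E -> E/W is a bijection. *)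
Definition bij_mod (F : fieldType) (E : lmodType F) (V W : set E) : Prop :=
  (forall x y, V x -> V y -> W (x - y) -> x = y) /\
  (forall z, exists2 x, V x & W (z - x)).

Definition ideal_gen (A : comNzRingType) (S : set A) : set A :=
  [set f | exists2 l : seq (A * A), (forall x, x \in l -> S x.2)
                                  & f = \sum_(x <- l) x.1 * x.2].

Lemma basis_mod_le (F : fieldType) (E : lmodType F) (V W : set E)
    (d e : nat) (b : 'I_d -> E) (c : 'I_e -> E) :
  subspace W -> basis_mod V W b -> basis_mod V W c -> (d <= e)%N.
Proof.
move=> [W0 WD WZ] [bV bfree _] [_ _ cgen].
have WB x y : W x -> W y -> W (x - y).
  by move=> Wx Wy; apply: WD => //; rewrite -scaleN1r; exact: WZ.
have Wsum (J : finType) (G : J -> E) : (forall i, W (G i)) -> W (\sum_i G i).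
  by move=> WG; apply: (big_ind W) => // *; exact: WD.
have /(@choice _ _ _) [A AP] : forall i, exists a : 'I_e -> F,
  W (b i - \sum_(j < e) a j *: c j) by move=> i; exact: cgen.
pose M : 'M[F]_(d, e) := \matrix_(i, j) A i j.
suff : row_free M by move=> /eqP <-; exact: rank_leq_col.
apply: inj_row_free => v vM0.
have Wb : W (\sum_(i < d) v 0 i *: b i).
  have -> : \sum_(i < d) v 0 i *: b i
     = \sum_(i < d) v 0 i *: (b i - \sum_(j < e) A i j *: c j).
    under [RHS]eq_bigr do rewrite scalerBr.
    rewrite sumrB [X in _ - X](_ : _ = 0) ?subr0 //.
    under eq_bigr do rewrite scaler_sumr.
    rewrite exchange_big /= big1 // => j _.
    under eq_bigr do rewrite scalerA.
    rewrite -scaler_suml; move/matrixP: vM0 => /(_ 0 j).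
    rewrite !mxE => vM0j; rewrite -[RHS](scale0r (c j)) -{2}vM0j.
    by congr (_ *: _); apply: eq_bigr => i _; rewrite mxE.
  by apply: Wsum => i; apply: WZ; exact: AP.
by apply/rowP => i; rewrite mxE; exact: (bfree (fun i => v 0 i)).
Qed.

Lemma dim_modE (F : fieldType) (E : lmodType F) (V W : set E)
    (d : nat) (b : 'I_d -> E) :
  subspace W -> basis_mod V W b -> dim_mod V W = d.
Proof.
move=> sW Bb; rewrite /dim_mod; case: xgetP => [e _ [c Bc]|]; last first.
  by move=> /(_ d) /=; case; exists b.
by apply/eqP; rewrite eqn_leq (basis_mod_le sW Bb Bc) (basis_mod_le sW Bc Bb).
Qed.

Lemma basis_mod_exists (F : fieldType) (E : lmodType F) (V W : set E)
    (n : nat) (g : 'I_n -> E) :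
  subspace W -> (forall i, V (g i)) ->
  (forall x, V x -> exists c : 'I_n -> F, x = \sum_(i < n) c i *: g i) ->
  exists b : 'I_(dim_mod V W) -> E, basis_mod V W b.
Proof.
move=> sW gV ggen; have [W0 WD WZ] := sW.
suff [d [b Bb]] : exists d, exists b : 'I_d -> E, basis_mod V W b.
  by rewrite (dim_modE sW Bb); exists b.
have {ggen} : forall x, V x -> exists c : 'I_n -> F,
    W (x - \sum_(i < n) c i *: g i).
  by move=> x /ggen [c ->]; exists c; rewrite subrr.
elim: n g gV => [|n IHn] g gV ggen.
  exists 0%N, g; split=> // c _; by case.
have [gfree|] := pselect (forall c : 'I_n.+1 -> F,
  W (\sum_(i < n.+1) c i *: g i) -> forall i, c i = 0).
  by exists n.+1, g; split.
move/existsNP=> [c /not_implyP [Wc /existsNP [i0 /eqP ci0]]].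
apply: (IHn (fun j => g (lift i0 j))) => // x /ggen [a Wa].
exists (fun j => a (lift i0 j) - a i0 / c i0 * c (lift i0 j)).
have := WD _ _ Wa (WZ (a i0 / c i0) _ Wc); congr W.
rewrite !(bigD1_ord i0) //= scalerDr scalerA divfK //.
under [X in _ = _ - X]eq_bigr do rewrite scalerBl -scalerA.
rewrite sumrB -scaler_sumr.
by rewrite opprD opprB -addrA addrACA addNr add0r [- _ + _]addrC.
Qed.

Lemma subspace_ideal_gen (F : fieldType) (N : nat) (S : set {mpoly F[N]}) :
  subspace (ideal_gen S).
Proof.
split=> [|x y [l lS ->] [l' lS' ->]|c x [l lS ->]].
- by exists [::] => //; rewrite big_nil.
- exists (l ++ l'); last by rewrite big_cat.
  by move=> z; rewrite mem_cat => /orP[/lS|/lS'].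
- exists [seq (c *: z.1, z.2) | z <- l].
    by move=> _ /mapP[z zl ->] /=; exact: lS.
  rewrite big_map scaler_sumr; apply: eq_bigr => z _ /=.
  by rewrite scalerAl.
Qed.

(* The k * n variables are indexed by 'I_(k * n), the pair (i, j) having index
   mxvec_index i j. *)
Definition xvar (F : fieldType) (k n : nat) (i : 'I_k) (j : 'I_n) :
  {mpoly F[k * n]} := 'X_(mxvec_index i j).

Definition diag_act (F : fieldType) (k n : nat) (s : 'S_n)
    (f : {mpoly F[k * n]}) : {mpoly F[k * n]} :=
  f \mPo [tuple mxvec (\matrix_(i < k, j < n) xvar F i (s j)) 0 u | u < k * n].

Lemma diag_act_xvar (F : fieldType) (k n : nat) (s : 'S_n) i j :
  diag_act s (xvar F i j) = @xvar F k n i (s j).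
Proof. by rewrite /diag_act comp_mpolyXU -tnth_nth tnth_mktuple mxvecE mxE. Qed.

Definition invariants (F : fieldType) (k n : nat) : set {mpoly F[k * n]} :=
  [set f | forall s : 'S_n, diag_act s f = f].

Definition invariants_pos (F : fieldType) (k n : nat) : set {mpoly F[k * n]} :=
  [set f | invariants f /\ f@_0%MM = 0].

Definition coinv_ideal (F : fieldType) (k n : nat) : set {mpoly F[k * n]} :=
  ideal_gen (@invariants_pos F k n).

(* Coefficient of q^j in the Hilbert series of the coinvariants.  The degree-j
   part of the quotient is the image of the space of forms of degree j. *)
Definition hilb (F : fieldType) (k n j : nat) : nat :=
  dim_mod [set f : {mpoly F[k * n]} | f \is j.-homog] (@coinv_ideal F k n).

Lemma hilbP (F : fieldType) (k n j : nat) :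
  exists b : 'I_(hilb F k n j) -> {mpoly F[k * n]},
    basis_mod [set f | f \is j.-homog] (@coinv_ideal F k n) b.
Proof.
pose I := [pred m : 'X_{1..(k * n)%N < j.+1} | mdeg m == j].
pose e (i : 'I_#|I|) : 'X_{1..(k * n)%N} := @enum_val _ I i.
apply: (@basis_mod_exists _ _ _ _ _ (fun i => 'X_[e i])).
- exact: subspace_ideal_gen.
- by move=> i /=; rewrite dhomogX; have := enum_valP i; rewrite inE.
move=> x /= xj; exists (fun i => x@_(e i)).
rewrite -(@big_enum_val _ _ _ _ I
  (fun m : 'X_{1..(k * n)%N < j.+1} => x@_m *: 'X_[m] : {mpoly F[k * n]})) /=.
rewrite -[LHS](pihomog_dE xj) (@pihomogwE _ _ _ _ j.+1) //.
rewrite mmeasureE big_seq; apply/bigmax_leqP_seq => m mx _.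
by move/dhomogP: xj => /(_ m mx) ->.
Qed.

Definition ps_mul (A : pzRingType) (u v : nat -> A) : nat -> A :=
  fun n => \sum_(i < n.+1) u i * v (n - i)%N.

(* The first n coefficients of 1/u, computed from u * (1/u) = 1 and meaningful
   when u 0 is a unit: see ps_mul_inv. *)
Fixpoint ps_inv_seq (A : unitRingType) (u : nat -> A) (n : nat) : seq A :=
  if n is n'.+1 then
    let s := ps_inv_seq u n' in
    rcons s ((u 0%N)^-1 *
      ((n' == 0%N)%:R - \sum_(i < n') u i.+1 * s`_(n' - i.+1)))
  else [::].

Definition ps_inv (A : unitRingType) (u : nat -> A) : nat -> A :=
  fun n => (ps_inv_seq u n.+1)`_n.

Definition ps_of_poly (A : nzRingType) (p : {poly A}) : nat -> A :=
  fun i => p`_i.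

Definition ps_trunc (A : nzRingType) (m : nat) (u : nat -> A) : {poly A} :=
  \poly_(i < m.+1) u i.

Lemma size_ps_inv_seq (A : unitRingType) (u : nat -> A) n :
  size (ps_inv_seq u n) = n.
Proof. by elim: n => //= n IH; rewrite size_rcons IH. Qed.

Lemma nth_ps_inv_seq (A : unitRingType) (u : nat -> A) n i :
  (i < n)%N -> (ps_inv_seq u n)`_i = ps_inv u i.
Proof.
elim: n => // n IH; rewrite ltnS leq_eqVlt => /predU1P[->|iltn] //.
by rewrite [ps_inv_seq u n.+1]/= nth_rcons size_ps_inv_seq iltn IH.
Qed.

Lemma ps_mul_inv (A : unitRingType) (u : nat -> A) :
  u 0%N \is a GRing.unit -> ps_mul u (ps_inv u) =1 (fun n => (n == 0%N)%:R).
Proof.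
move=> u0 n; rewrite /ps_mul big_ord_recl subn0.
have -> : ps_inv u n = (u 0%N)^-1 *
    ((n == 0%N)%:R - \sum_(i < n) u i.+1 * (ps_inv_seq u n)`_(n - i.+1)).
  by rewrite {1}/ps_inv /= nth_rcons size_ps_inv_seq ltnn eqxx.
rewrite mulVKr // -addrA [X in _ + X](_ : _ = 0) ?addr0 //.
rewrite addrC; apply/eqP; rewrite subr_eq0; apply/eqP/eq_bigr => i _.
by rewrite nth_ps_inv_seq // ltn_subrL (leq_trans _ (ltn_ord i)).
Qed.

Definition hilb_series (F : fieldType) (k n : nat) : nat -> int :=
  fun j => (hilb F k n j)%:Z.

Definition vweight (k : nat) (a : k.-tuplelexi nat) : nat :=
  (\sum_(i < k) tnth a i)%N.

Definition powersum (F : fieldType) (k n : nat) (a : k.-tuplelexi nat) :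
  {mpoly F[k * n]} := \sum_(j < n) \prod_(i < k) xvar F i j ^+ tnth a i.

Definition seqweight (k : nat) (s : seq (k.-tuplelexi nat)) : nat :=
  (\sum_(a <- s) vweight a)%N.

(* <=%O on k.-tuplelexi nat is the lexicographic order. *)
Definition admissible (k m : nat) : set (seq (k.-tuplelexi nat)) :=
  [set s : seq (k.-tuplelexi nat) |
    [/\ sorted (<=%O : rel (k.-tuplelexi nat)) s,
        forall a, a \in s -> a <> [tuple 0%N | _ < k]
      & (seqweight s <= m)%N]].

Definition graded_subspace (F : fieldType) (N : nat) (V : set {mpoly F[N]}) :=
  subspace V /\ (forall f d, V f -> V (pihomog mdeg d f)).

(* A finitely supported sum is 0 by convention when the support is infinite;
   here the index set is finite, see finite_admissible. *)
Definition quasifree (F : fieldType) (k m : nat) : Prop :=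
  forall V : set {mpoly F[k * m]},
    graded_subspace V -> bij_mod V (@coinv_ideal F k m) ->
  forall v : seq (k.-tuplelexi nat) -> {mpoly F[k * m]},
    (forall s, admissible m s ->
       V (v s) /\ (msize (v s) <= (m - seqweight s).+1)%N) ->
    \sum_(s \in @admissible k m) (v s * \prod_(a <- s) powersum F m a) = 0 ->
  forall s, admissible m s -> v s = 0.

Lemma finite_admissible (k m : nat) : finite_set (@admissible k m).
Proof.
pose T := {r : 'I_m.+1 & r.-tuple (k.-tuple 'I_m.+1)}.
pose f (t : T) : seq (k.-tuplelexi nat) :=
  [seq [tuple nat_of_ord (tnth a i) | i < k] | a : k.-tuple 'I_m.+1 <- tagged t].
apply: (@sub_finite_set _ _ (f @` [set: T])); last first.
  by apply: finite_image; exact: finite_finset.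
move=> s [_ snz sm] /=.
have szs : (size s <= seqweight s)%N.
  rewrite /seqweight -sum1_size !big_seq leq_sum // => a /snz a0.
  rewrite lt0n; apply/negP; rewrite sum_nat_eq0 => a0'; apply: a0; move: a0'.
  move=> /forallP a0; apply: eq_from_tnth => i.
  by rewrite tnth_mktuple; apply/eqP; exact: a0.
have sb a i : a \in s -> (tnth a i <= m)%N.
  move=> ain; apply: leq_trans sm; rewrite /seqweight (big_rem a) //=.
  by rewrite /vweight (bigD1 i) //= -addnA leq_addr.
have szm : (size s < m.+1)%N by rewrite ltnS (leq_trans szs).
pose g (a : k.-tuplelexi nat) : k.-tuple 'I_m.+1 :=
  [tuple inord (tnth a i) | i < k].
have szg : size [seq g a | a <- s] == Ordinal szm by rewrite size_map.
exists (Tagged (fun r : 'I_m.+1 => r.-tuple (k.-tuple 'I_m.+1)) (Tuple szg)) => //.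
rewrite /f /= -map_comp -[RHS]map_id; apply/eq_in_map => a ain /=.
apply: eq_from_tnth => i; rewrite !tnth_mktuple inordK // ltnS.
exact: sb.
Qed.

(* Main.v *)
From HB Require Import structures.
Require Import Defs.
From mathcomp Require Import all_boot all_order all_algebra all_fingroup.
From mathcomp Require Import all_classical reals.
From mathcomp Require Import mpoly complex.
Import Order.TTheory GRing.Theory.
Local Open Scope ring_scope.

Set Implicit Arguments.
Unset Strict Implicit.
Unset Printing Implicit Defensive.

(* The ideal generated by the invariants of positive degree is generated by the
   power sums p_a.  Write n = m + t and view the polynomials on n columns of
   variables as polynomials in the last t columns with coefficients in R^(k,m).
   There p_(a,n) = p_(a,m) + (power sum of the last t columns), so the part of
   lowest degree in the last columns of a relation between products of the
   p_(a,n) is a relation between products of the p_(a,m).  The Quasifree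
   Conjecture for m thus extends to coefficients in V^(k,m) tensored with the
   polynomials in the last t columns, and in degrees at most m this tensor
   product is a complement of the coinvariant ideal for n. *)

(** * Orbit sums and ideals containing the power sums *)

Section OrbitSums.
Variables (A : comNzRingType) (k n : nat) (u : 'X_{1..k} -> 'I_n -> A).
Hypothesis uD : forall a b j, u (a + b)%MM j = u a j * u b j.

(** For [u := colmon] this is the symmetrization over ['S_n] of the monomial with column exponents
    [al]; each monomial of the orbit is repeated as often as its stabilizer has elements. *)
Definition orbit_sum (al : 'I_n -> 'X_{1..k}) : A :=
  \sum_(s : 'S_n) \prod_j u (al j) (s j).

Lemma eq_orbit_sum al be : al =1 be -> orbit_sum al = orbit_sum be.
Proof.
by move=> e; apply: eq_bigr => s _; apply: eq_bigr => j _; rewrite e.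
Qed.

Lemma orbit_sum_perm al (t : 'S_n) : orbit_sum (al \o t) = orbit_sum al.
Proof.
rewrite /orbit_sum (reindex_inj (mulgI t)) /=; apply: eq_bigr => s _.
rewrite [RHS](reindex_inj (@perm_inj _ t)) /=.
by apply: eq_bigr => j _; rewrite permM.
Qed.

(** For fixed [s] the power sum can be indexed by [l = s i]; by [uD] its [i]-th summand then adds
    [a] to the [i]-th entry. *)
Lemma orbit_sumM a al :
  orbit_sum al * \sum_l u a l =
  \sum_i orbit_sum (fun j => if j == i then (a + al j)%MM else al j).
Proof.
rewrite /orbit_sum exchange_big mulr_suml; apply: eq_bigr => s _ /=.
rewrite [X in _ * X](reindex_inj (@perm_inj _ s)) mulr_sumr.
apply: eq_bigr => i _ /=.
rewrite (bigD1 i) //= [RHS](bigD1 i) //= eqxx uD.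
rewrite mulrAC [_ * u a _]mulrC; congr (_ * _).

by apply: eq_bigr => j /negPf ->.
Qed.

Variable K : A -> Prop.
Hypothesis KD : forall x y, K x -> K y -> K (x + y).
Hypothesis KM : forall x y, K y -> K (x * y).
Hypothesis Kn : forall c x, K (x *+ c.+1) -> K x.
Hypothesis Kp : forall a, a != 0%MM -> K (\sum_l u a l).

(* With al' the family obtained from al by replacing the nonzero a = al j0 by 0,
   the product of the orbit sum of al' and the power sum of a is a positive
   multiple of the orbit sum of al (the terms i with al' i = 0), plus orbit sums
   of families with fewer nonzero entries. *)
Lemma orbit_sum_ideal al j0 : al j0 != 0%MM -> K (orbit_sum al).
Proof.
move Ec : #|[pred j | al j != 0%MM]| => c.
elim/ltn_ind: c al j0 Ec => c IHc al j0 Ec a0.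
have K0 : K 0 by rewrite -(mul0r (\sum_l u (al j0) l)); apply/KM/Kp.
have KB x y : K x -> K y -> K (x - y).
  by move=> Kx Ky; apply: KD => //; rewrite -mulN1r; exact: KM.
set al' := fun j => if j == j0 then 0%MM else al j.
pose be i := fun j => if j == i then (al j0 + al' j)%MM else al' j.
(* Such a [be i] is [al] with the positions [i] and [j0] exchanged. *)
have beE i : al' i = 0%MM -> orbit_sum (be i) = orbit_sum al.
  move=> i0; rewrite -(orbit_sum_perm _ (tperm i j0)); apply: eq_orbit_sum => j.
  rewrite /be /al' /=; case: tpermP => [->|->|/eqP ji /eqP jj0].
  - rewrite eqxx eq_sym.
    by case: eqVneq i0 => [->|]; rewrite /al' ?addm0 //; case: eqP.
  - by rewrite eqxx /= -/(al' i) i0 addm0.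
  - by rewrite (negPf ji) (negPf jj0).
have := orbit_sumM (al j0) al'; rewrite -/be.
rewrite [X in _ = X](bigID (fun i => al' i == 0%MM)) /=.
rewrite [X in X + _](eq_bigr (fun=> orbit_sum al)); last first.
  by move=> i /eqP /beE.
rewrite sumr_const.
have : (0 < #|[pred i | al' i == 0%MM]|)%N.
  by apply/card_gt0P; exists j0; rewrite inE /al' eqxx.
case: #|_| => // q _ eq_al; apply: (Kn (c := q)).
suff : K (\sum_(i | al' i != 0%MM) orbit_sum (be i)).
  move/(KB _ _ (KM (orbit_sum al') (Kp a0))).
  by rewrite eq_al addrK.
(* Here [i] was already a nonzero position and [j0] has been vacated, so [be i] has fewer nonzero
   entries than [al]. *)
apply: (big_ind K) => // i i0; apply: (IHc _ _ (be i) i erefl).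
  rewrite -Ec; apply: proper_card; apply/properP; split.
    apply/fintype.subsetP => j; rewrite !inE /be /al'.
    case: (eqVneq j j0) => [->|_] //.
    case: (eqVneq j i) => [->|_] //.
    by move: i0; rewrite /al'; case: ifP; rewrite ?eqxx.
  have /negPf j0i : j0 != i by apply: contraNneq i0 => <-; rewrite /al' eqxx.
  by exists j0; rewrite !inE // /be j0i /al' eqxx eqxx.
by rewrite /be eqxx mnmD_eq0 (negPf a0).
Qed.
End OrbitSums.

(** * Generation of the positive-degree invariants by power sums *)

Lemma ideal_genD (A : comNzRingType) (S : set A) x y :
  ideal_gen S x -> ideal_gen S y -> ideal_gen S (x + y).
Proof.
move=> [l lS ->] [l' lS' ->]; exists (l ++ l'); last by rewrite big_cat.
by move=> z; rewrite mem_cat => /orP[/lS|/lS'].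
Qed.

Lemma ideal_genM (A : comNzRingType) (S : set A) x y :
  ideal_gen S y -> ideal_gen S (x * y).
Proof.
move=> [l lS ->]; exists [seq (x * z.1, z.2) | z <- l].
  by move=> _ /mapP[z zl ->] /=; exact: lS.
by rewrite big_map mulr_sumr; apply: eq_bigr => z _ /=; rewrite mulrA.
Qed.

Lemma ideal_gen_mem (A : comNzRingType) (S : set A) x : S x -> ideal_gen S x.
Proof.
move=> Sx; exists [:: (1, x)]; last by rewrite big_seq1 mul1r.
by move=> z; rewrite inE => /eqP ->.
Qed.

Lemma ideal_gen0 (A : comNzRingType) (S : set A) : ideal_gen S 0.
Proof. by exists [::] => //; rewrite big_nil. Qed.

Definition colexp (k n : nat) (M : 'X_{1..k * n}) (j : 'I_n) : 'X_{1..k} :=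
  [multinom M (mxvec_index i j) | i < k].

Lemma prod_colexp (A : comNzRingType) (k n : nat) (h : 'I_(k * n) -> A)
    (M : 'X_{1..k * n}) :
  mmap1 h M = \prod_j mmap1 (fun i => h (mxvec_index i j)) (colexp M j).
Proof.
rewrite /mmap1.
transitivity (\prod_(p : 'I_k * 'I_n)
    h (mxvec_index p.1 p.2) ^+ M (mxvec_index p.1 p.2)).
  by rewrite (reindex _ (curry_mxvec_bij k n)); apply: eq_bigr => -[].
rewrite -(pair_bigA _ (fun i j => h (mxvec_index i j) ^+ M (mxvec_index i j))) /=.
rewrite exchange_big; apply: eq_bigr => j _; apply: eq_bigr => i _.
by rewrite mnmE.
Qed.

Section PowerSums.
Variables (F : fieldType) (k n : nat).
Implicit Type a : k.-tuplelexi nat.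

Definition colmon (a : 'X_{1..k}) (j : 'I_n) : {mpoly F[k * n]} :=
  \prod_(i < k) xvar F i j ^+ a i.

Lemma mpolyX_colmon M : 'X_[M] = \prod_j colmon (colexp M j) j.
Proof. by rewrite -mmap1_id prod_colexp. Qed.

Lemma diag_actX s M : diag_act s 'X_[M] = \prod_j colmon (colexp M j) (s j).
Proof.
rewrite mpolyX_colmon /diag_act rmorph_prod; apply: eq_bigr => j _.
rewrite rmorph_prod; apply: eq_bigr => i _.
by rewrite rmorphXn /= -/(diag_act s _) diag_act_xvar.
Qed.

Lemma powersumE (a : 'X_{1..k}) : powersum F n a = \sum_j colmon a j.
Proof. by []. Qed.

Definition powersum_ideal : set {mpoly F[k * n]} :=
  ideal_gen [set p | exists2 a, a <> [tuple 0%N | _ < k] & p = powersum F n a].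

Hypothesis char0 : [pchar F] =i pred0.

(** By invariance, n! times [f] is the sum of its translates, hence a combination of orbit sums of
    its monomials. None of these is constant since [f@_0 = 0], so [orbit_sum_ideal] applies;
    characteristic 0 permits division by n!. *)
Lemma invariants_pos_powersum_ideal f : @invariants_pos F k n f -> powersum_ideal f.
Proof.
move=> [finv f0].
have Kn c (x : {mpoly F[k * n]}) : powersum_ideal (x *+ c.+1) -> powersum_ideal x.
  rewrite -scaler_nat => /(ideal_genM (c.+1%:R^-1)%:MP).
  rewrite mul_mpolyC scalerA mulVf ?scale1r //.
  by move/pcharf0P: char0 => ->.
suff : powersum_ideal (\sum_(s : 'S_n) diag_act s f).
  rewrite (eq_bigr (fun=> f)) => [|s _]; last exact: finv.
  by rewrite sumr_const card_Sn -(prednK (fact_gt0 n)); apply: Kn.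
have -> : \sum_(s : 'S_n) diag_act s f =
    \sum_(M <- msupp f) f@_M *: orbit_sum colmon (colexp M).
  under eq_bigr do rewrite {1}[f]mpolyE /diag_act raddf_sum /=.
  rewrite exchange_big; apply: eq_bigr => M _.
  by rewrite scaler_sumr; apply: eq_bigr => s _; rewrite linearZ /= -diag_actX.
rewrite big_seq; apply: (big_ind powersum_ideal) => [|x y|M].
- exact: ideal_gen0.
- exact: ideal_genD.
rewrite -mul_mpolyC => fM; apply: ideal_genM.
have [j Mj] : exists j, colexp M j != 0%MM.
  apply/not_existsP => M0; move: fM; rewrite mcoeff_msupp -f0.
  suff -> : M = 0%MM by rewrite eqxx.
  apply/mnmP => u; case/mxvec_indexP: u => i j; have := M0 j.
  move/negP; rewrite negbK => /eqP/mnmP/(_ i).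
  by rewrite !mnmE.
apply: (orbit_sum_ideal (u := colmon) (K := powersum_ideal) _ _ _ Kn _ Mj).
- move=> a b l; rewrite /colmon -big_split; apply: eq_bigr => i _.
  by rewrite mnmDE exprD.
- exact: ideal_genD.
- exact: ideal_genM.
move=> a a0; apply: ideal_gen_mem; exists a; last exact: powersumE.
move=> a00; case/eqP: a0; apply/mnmP => i.
by rewrite mnm_tnth a00 tnth_mktuple mnm0E.
Qed.
End PowerSums.

(** * Homogeneous components of the coinvariant ideal *)

Lemma mmap1_homog (F : fieldType) (N p : nat) (h : 'I_p -> {mpoly F[N]}) M :
  (forall u, h u \is 1.-homog) -> mmap1 h M \is (mdeg M).-homog.
Proof.
move=> h1; rewrite mdegE /mmap1.
elim/big_rec2: _ => [|u x d _ xd]; first exact: dhomog1.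
by apply: dhomogM => //; have := dhomogMn (M u) (h1 u); rewrite mul1n.
Qed.

(** By linearity [p] may be a monomial, and then [p * q] is homogeneous. The test [e <= d] guards
    against truncated subtraction, which for [d < e] would let the constant term of [p] survive. *)
Lemma pihomogM (F : fieldType) (N d e : nat) (p q : {mpoly F[N]}) :
  q \is e.-homog ->
  pihomog mdeg d (p * q) =
  if (e <= d)%N then pihomog mdeg (d - e) p * q else 0.
Proof.
move=> qe; rewrite [p]mpolyE mulr_suml [LHS]raddf_sum /=.
have Xq M : 'X_[M] * q \is (mdeg M + e).-homog.
  by apply: dhomogM => //; rewrite dhomogX.
case: leqP => ed.
  rewrite raddf_sum mulr_suml; apply: eq_bigr => M _ /=.
  rewrite -scalerAl !linearZ /= -scalerAl; congr (_ *: _).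
  rewrite pihomogX; case: eqP => [Md|Md].
    by rewrite pihomog_dE // -(subnK ed) -Md.
  rewrite mul0r; apply: (pihomog_ne0 _ (Xq M)); apply/eqP => Mde.
  by apply: Md; rewrite -Mde addnK.
rewrite big1 // => M _.
rewrite -scalerAl linearZ /= (pihomog_ne0 _ (Xq M)) ?scaler0 //.
by rewrite neq_ltn (leq_trans ed) ?orbT // leq_addl.
Qed.

Section CoinvIdeal.
Variables (F : fieldType) (k n : nat).
Implicit Type a : k.-tuplelexi nat.
Local Notation J := (@coinv_ideal F k n).
Local Notation zero := [tuple 0%N | _ < k].

Lemma vweight_mdeg a : vweight a = mdeg [multinom a].
Proof. by rewrite mdegE; apply: eq_bigr => i _; rewrite multinomE. Qed.

Lemma vweight_gt0 a : a <> zero -> (0 < vweight a)%N.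
Proof.
move=> a0; rewrite lt0n vweight_mdeg mdeg_eq0; apply/eqP => /mnmP e; apply: a0.
by apply: eq_from_tnth => i; move: (e i); rewrite multinomE mnm0E tnth_mktuple.
Qed.

Lemma colmon_homog (a : 'X_{1..k}) (j : 'I_n) : colmon F a j \is (mdeg a).-homog.
Proof. by apply: mmap1_homog => i; rewrite dhomogX /= mdeg1. Qed.

Lemma powersum_homog a : powersum F n a \is (vweight a).-homog.
Proof.
rewrite vweight_mdeg -[a]/(multinom_val [multinom a]) powersumE rpred_sum // => j _.
exact: colmon_homog.
Qed.

Lemma powersum_coinv a : a <> zero -> J (powersum F n a).
Proof.
move=> a0; apply: ideal_gen_mem; split; last first.
  apply: (dhomog_nemf_coeff (powersum_homog a)).
  by rewrite /= mdeg0 eq_sym -lt0n vweight_gt0.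
move=> s; rewrite /powersum /diag_act raddf_sum /=.
rewrite [RHS](reindex_inj (@perm_inj _ s)) /=; apply: eq_bigr => j _.
rewrite rmorph_prod; apply: eq_bigr => i _.
by rewrite rmorphXn /= -/(diag_act s _) diag_act_xvar.
Qed.

Hypothesis char0 : [pchar F] =i pred0.

Lemma coinv_powersums f : J f ->
  exists2 l : seq ({mpoly F[k * n]} * k.-tuplelexi nat),
    forall x, x \in l -> x.2 <> zero & f = \sum_(x <- l) x.1 * powersum F n x.2.
Proof.
move=> Jf; have {Jf} : @powersum_ideal F k n f.
  case: Jf => l lI ->; rewrite big_seq.
  apply: (big_ind (@powersum_ideal F k n)) => [|x y|x xl].
  - exact: ideal_gen0.
  - exact: ideal_genD.
  exact/ideal_genM/(invariants_pos_powersum_ideal char0)/lI.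
case=> l lP ->.
elim: l lP => [|[r p] l IHl] lP; first by exists [::]; rewrite ?big_nil.
have [|l' l'P e] := IHl; first by move=> x xl; apply: lP; rewrite inE xl orbT.
have /= [a a0 ->] := lP _ (mem_head _ _).
exists ((r, a) :: l'); last by rewrite !big_cons e.
by move=> x; rewrite inE => /predU1P [->|/l'P].
Qed.

(** The generators are homogeneous, so taking the degree-[d] part only cuts down the cofactors, and
    power sums of weight above [d] drop out. *)
Lemma coinv_pihomog d f : J f ->
  exists2 l : seq ({mpoly F[k * n]} * k.-tuplelexi nat),
    forall x, x \in l -> [/\ x.2 <> zero, (vweight x.2 <= d)%N
                          & x.1 \is (d - vweight x.2).-homog]
    & pihomog mdeg d f = \sum_(x <- l) x.1 * powersum F n x.2.
Proof.
case/coinv_powersums => l l0 ->; rewrite raddf_sum /=.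
exists [seq (pihomog mdeg (d - vweight x.2) x.1, x.2) |
  x <- l & (vweight x.2 <= d)%N].
  move=> _ /mapP [x + ->] /=; rewrite mem_filter => /andP [xd /l0 x0].
  by split => //; exact: pihomogP.
rewrite big_map big_filter [RHS]big_mkcond /=; apply: eq_bigr => x _.
exact/pihomogM/powersum_homog.
Qed.

Lemma coinv_graded d f : J f -> J (pihomog mdeg d f).
Proof.
case/(coinv_pihomog d) => l lP ->; rewrite big_seq; apply: (big_ind J).
- exact: ideal_gen0.
- exact: ideal_genD.
by move=> x /lP [x0 _ _]; apply/ideal_genM/powersum_coinv.
Qed.

End CoinvIdeal.

(** * Separating the last [t] columns of variables *)

Section Split.
Variables (F : fieldType) (k m t : nat).
Local Notation R := {mpoly F[k * m]}.
Local Notation E := {mpoly {mpoly F[k * m]}[k * t]}.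
Local Notation Rn := {mpoly F[k * (m + t)]}.
Implicit Type a : k.-tuplelexi nat.

Definition by_cols (A : Type) (n : nat) (h : 'I_k -> 'I_n -> A) : 'I_(k * n) -> A :=
  fun u => mxvec (\matrix_(i, j) h i j) 0 u.

Lemma by_colsE (A : Type) (n : nat) (h : 'I_k -> 'I_n -> A) i j :
  by_cols h (mxvec_index i j) = h i j.
Proof. by rewrite /by_cols mxvecE mxE. Qed.

Definition incl : R -> Rn :=
  mmap (@mpolyC (k * (m + t)) F) (by_cols (fun i j => xvar F i (lshift t j))).

HB.instance Definition _ := GRing.RMorphism.on incl.

(* R^(k,m+t) as the ring of polynomials in the last t columns of variables with
   coefficients in R^(k,m); splitp is the inverse of joinp. *)
Definition joinp : E -> Rn :=
  mmap incl (by_cols (fun i j => xvar F i (rshift m j))).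

HB.instance Definition _ := GRing.RMorphism.on joinp.

Definition splitp : Rn -> E :=
  mmap (@mpolyC (k * t) R \o @mpolyC (k * m) F) (by_cols (fun i j =>
    match fintype.split j with
    | inl j' => (xvar F i j')%:MP
    | inr j' => 'X_(mxvec_index i j')
    end)).

HB.instance Definition _ := GRing.RMorphism.on splitp.

Lemma incl_xvar i j : incl (xvar F i j) = xvar F i (lshift t j).
Proof. by rewrite /incl mmapX mmap1U by_colsE. Qed.

Lemma joinpC c : joinp c%:MP = incl c.
Proof. exact: mmapC. Qed.

Lemma joinpZ c v g : c *: joinp (v%:MP * g) = joinp ((c *: v)%:MP * g).
Proof.
rewrite !rmorphM /= !joinpC -!mul_mpolyC mulrA; congr (_ * _).
by rewrite rmorphM /= /incl mmapC.
Qed.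

Lemma joinp_var i j : joinp 'X_(mxvec_index i j) = xvar F i (rshift m j).
Proof. by rewrite /joinp mmapX mmap1U by_colsE. Qed.

Lemma splitp_xvarl i j : splitp (xvar F i (lshift t j)) = (xvar F i j)%:MP.
Proof. by rewrite /splitp mmapX mmap1U by_colsE (unsplitK (inl j)). Qed.

Lemma splitp_xvarr i j : splitp (xvar F i (rshift m j)) = 'X_(mxvec_index i j).
Proof. by rewrite /splitp mmapX mmap1U by_colsE (unsplitK (inr j)). Qed.

Lemma splitp_incl c : splitp (incl c) = c%:MP.
Proof.
rewrite {1}/incl /mmap rmorph_sum [c in RHS]mpolyE [RHS]raddf_sum.
apply: eq_bigr => M _; rewrite rmorphM /= {1}/splitp mmapC /=.
rewrite -mul_mpolyC mpolyCM mpolyX_colmon prod_colexp; congr (_ * _).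
rewrite !rmorph_prod; apply: eq_bigr => j _; rewrite !rmorph_prod.
by apply: eq_bigr => i _; rewrite !rmorphXn /= by_colsE splitp_xvarl.
Qed.

(** Gives injectivity of [joinp], so that a relation in [Rn] can be read in [E]; surjectivity is
    obtained monomial by monomial from [mpolyX_joinp]. *)
Lemma joinpK : cancel joinp splitp.
Proof.
move=> g; rewrite {1}/joinp /mmap rmorph_sum [RHS]mpolyE.
apply: eq_bigr => M _; rewrite rmorphM /= splitp_incl mul_mpolyC -mmap1_id.
congr (_ *: _); rewrite rmorph_prod; apply: eq_bigr => u _.
by rewrite rmorphXn /=; case/mxvec_indexP: u => i j; rewrite by_colsE splitp_xvarr.
Qed.

Definition rmono a (j : 'I_t) : 'X_{1..k * t} :=
  (\sum_(i < k) U_(mxvec_index i j) *+ tnth a i)%MM.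

(* The polynomial that joinp sends to the power sum of all m + t columns. *)
Definition lpow a : E := (powersum F m a)%:MP + \sum_j 'X_[rmono a j].

Lemma mdeg_rmono a j : mdeg (rmono a j) = vweight a.
Proof.
rewrite mdeg_sum; apply: eq_bigr => i _.
by rewrite mdegMn mdeg1 mul1n.
Qed.

Lemma joinp_lpow a : joinp (lpow a) = powersum F (m + t) a.
Proof.
rewrite rmorphD /= joinpC /powersum big_split_ord /= !rmorph_sum /=; congr (_ + _).
  apply: eq_bigr => j _; rewrite rmorph_prod; apply: eq_bigr => i _.
  by rewrite rmorphXn /= incl_xvar.
apply: eq_bigr => j _; rewrite -mprodXnE rmorph_prod; apply: eq_bigr => i _.
by rewrite rmorphXn /= joinp_var.
Qed.

(** Each [rmono a j] has positive degree [vweight a]. This is what turns lowest terms of relations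
    between the [lpow a] into relations between power sums of [m] columns. *)
Lemma mcoeff0_lpow a : a <> [tuple 0%N | _ < k] -> (lpow a)@_0%MM = powersum F m a.
Proof.
move=> a0; rewrite mcoeffD mcoeffC eqxx mulr1 raddf_sum big1 ?addr0 //= => j _.
rewrite mcoeffX -mdeg_eq0 mdeg_rmono.
by rewrite -leqn0 leqNgt vweight_gt0.
Qed.

Lemma incl_homog e c : c \is e.-homog -> incl c \is e.-homog.
Proof.
move=> /dhomogP ce; rewrite /incl /mmap big_seq rpred_sum // => M /ce <-.
rewrite mul_mpolyC rpredZ // mmap1_homog // => u.
by case/mxvec_indexP: u => i j; rewrite by_colsE dhomogX /= mdeg1.
Qed.

Lemma joinp_homog e c mu :
  c \is e.-homog -> joinp (c%:MP * 'X_[mu]) \is (e + mdeg mu).-homog.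
Proof.
move=> ce; rewrite rmorphM /= joinpC; apply: dhomogM; first exact: incl_homog.
rewrite /joinp mmapX mmap1_homog // => u.
by case/mxvec_indexP: u => i j; rewrite by_colsE dhomogX /= mdeg1.
Qed.

Lemma mpolyX_joinp M : exists c mu,
  mdeg M = (mdeg c + mdeg mu)%N /\ 'X_[M] = joinp ('X_[c]%:MP * 'X_[mu]).
Proof.
pose c :=
  [multinom by_cols (fun i j => M (mxvec_index i (lshift t j))) u | u < k * m].
pose mu :=
  [multinom by_cols (fun i j => M (mxvec_index i (rshift m j))) u | u < k * t].
exists c, mu; suff XM : 'X_[M] = joinp ('X_[c]%:MP * 'X_[mu]).
  (* The degrees add up because both sides of [XM] are homogeneous. *)
  split=> //; apply/eqP; have /joinp_homog -/(_ mu) : 'X_[F, c] \is (mdeg c).-homog.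
    by rewrite dhomogX.
  by rewrite -XM dhomogX.
rewrite rmorphM /= joinpC mpolyX_colmon big_split_ord /=; congr (_ * _).
  rewrite mpolyX_colmon rmorph_prod; apply: eq_bigr => j _.
  rewrite rmorph_prod; apply: eq_bigr => i _.
  by rewrite rmorphXn /= incl_xvar !mnmE by_colsE.
rewrite /joinp mmapX prod_colexp; apply: eq_bigr => j _; apply: eq_bigr => i _.
by rewrite by_colsE !mnmE by_colsE.
Qed.
End Split.

(** * Extending the Quasifree Conjecture to coefficients involving the last columns *)

Lemma mcoeff_low (A : comNzRingType) (N : nat) (p q : {mpoly A[N]}) M :
  (forall M', (mdeg M' < mdeg M)%N -> p@_M' = 0) -> (p * q)@_M = p@_M * q@_0%MM.
Proof.
move=> plow; rewrite mcoeffM.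
have M_lt : (mdeg M < (mdeg M).+1)%N by [].
pose i0 : 'X_{1..N < (mdeg M).+1, (mdeg M).+1} :=
  (BMultinom M_lt, bm0).
rewrite (bigD1 i0) /= ?addm0 // big1 ?addr0 // => -[x y] /= /andP [/eqP eM ne].
(* If [y] is nonzero, [x] has smaller degree than [M], where [p] vanishes. *)
have [y0|y0] := eqVneq (y : 'X_{1..N}) 0%MM; last first.
  rewrite plow ?mul0r // [ltnRHS](congr1 mdeg eM) mdegD -[ltnLHS]addn0.
  by rewrite ltn_add2l lt0n mdeg_eq0.
case/eqP: ne; congr (_, _); apply/val_inj => //=.
by move: (esym eM); rewrite y0 addm0.
Qed.

Lemma admissible_nonzero k m s a :
  admissible m s -> a \in s -> a <> [tuple 0%N | _ < k].
Proof. by case=> _ s0 _; exact: s0. Qed.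

Section QuasifreeLift.
Variables (F : fieldType) (k m t : nat).
Local Notation R := {mpoly F[k * m]}.
Local Notation E := {mpoly {mpoly F[k * m]}[k * t]}.
Local Notation q := (@lpow F k m t).
Hypothesis qf : quasifree F k m.

(** Induction on the degree of [mu], for all [s] at once: when every [W s] vanishes below that
    degree, [mcoeff_low] makes the coefficient of the relation at [mu] an instance of the conjecture
    for the [(W s)@_mu]. *)
Lemma quasifree_lift (V : set R) (W : seq (k.-tuplelexi nat) -> E) :
  graded_subspace V -> bij_mod V (@coinv_ideal F k m) ->
  (forall s mu, admissible m s ->
     V (W s)@_mu /\ (msize (W s)@_mu <= (m - seqweight s).+1)%N) ->
  \sum_(s \in @admissible k m) (W s * \prod_(a <- s) q a) = 0 ->
  forall s, admissible m s -> W s = 0.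
Proof.
move=> gV bV WV W0.
suff W0mu d mu : (mdeg mu < d)%N -> forall s, admissible m s -> (W s)@_mu = 0.
  by move=> s sm; apply/mpolyP => mu; rewrite mcoeff0 (W0mu (mdeg mu).+1).
elim: d mu => // d IHd mu; rewrite ltnS => mud.
apply: (qf gV bV (v := fun s => (W s)@_mu)) => [s sm|]; first exact: WV.
have fA := finite_admissible k m.
rewrite fsbig_finite //=; move: W0; rewrite fsbig_finite //=.
move/(congr1 (mcoeff mu)); rewrite mcoeff0 raddf_sum /= => W0.
rewrite -[RHS]W0; apply: eq_big_seq => s.
rewrite in_fset_set // inE => sm; rewrite mcoeff_low => [|M' M'mu]; last first.
  by apply: IHd => //; exact: leq_trans mud.
congr (_ * _); rewrite rmorph_prod big_seq [RHS]big_seq.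
by apply: eq_bigr => a /(admissible_nonzero sm) a0; rewrite /= mcoeff0_lpow.
Qed.
End QuasifreeLift.

(** * A graded complement of the coinvariant ideal *)

Section HomogeneousComplement.
Variables (F : fieldType) (k m : nat).
Hypothesis char0 : [pchar F] =i pred0.
Local Notation R := {mpoly F[k * m]}.
Local Notation J := (@coinv_ideal F k m).
Variable b : forall e, 'I_(hilb F k m e) -> R.
Hypothesis bP : forall e, basis_mod [set f : R | f \is e.-homog] J (b (e := e)).

Definition bspan e : set R :=
  [set v | exists c : 'I_(hilb F k m e) -> F, v = \sum_i c i *: b i].

(** The direct sum of the spans of the chosen forms; it serves as the subspace [V] to which
    [quasifree] is applied. *)
Definition complement : set R := [set v | forall e, bspan e (pihomog mdeg e v)].

Lemma bspan0 e : bspan e 0.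
Proof. by exists (fun=> 0); rewrite big1 // => i _; rewrite scale0r. Qed.

Lemma bspanD e v w : bspan e v -> bspan e w -> bspan e (v + w).
Proof.
move=> [c ->] [d ->]; exists (fun i => c i + d i).
by rewrite -big_split; apply: eq_bigr => i _; rewrite scalerDl.
Qed.

Lemma bspanZ e x v : bspan e v -> bspan e (x *: v).
Proof.
move=> [c ->]; exists (fun i => x * c i).
by rewrite scaler_sumr; apply: eq_bigr => i _; rewrite scalerA.
Qed.

Lemma bspan_homog e v : bspan e v -> v \is e.-homog.
Proof.
move=> [c ->]; rewrite rpred_sum // => i _; rewrite rpredZ //.
by have [bh _ _] := bP e; exact: bh.
Qed.

Lemma bspan_basis e i : bspan e (b (e := e) i).
Proof.
exists (fun i' => (i' == i)%:R); rewrite (bigD1 i) //= eqxx scale1r.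
by rewrite big1 ?addr0 // => i' /negPf ->; rewrite scale0r.
Qed.

Lemma bspan_complement e v : bspan e v -> complement v.
Proof.
move=> ve d; have vh := bspan_homog ve.
have [->|ne] := eqVneq d e; first by rewrite pihomog_dE.
by rewrite (pihomog_ne0 _ vh) 1?eq_sym //; exact: bspan0.
Qed.

Lemma bspan_coinv0 e v : bspan e v -> J v -> v = 0.
Proof.
move=> [c ->]; have [_ free _] := bP e.
by move=> /free c0; rewrite big1 // => i _; rewrite c0 scale0r.
Qed.

Lemma homog_bspan e f : f \is e.-homog -> exists2 v, bspan e v & J (f - v).
Proof.
have [_ _ gen] := bP e; move=> /gen [c Jc].
by exists (\sum_i c i *: b i) => //; exists c.
Qed.

Lemma subspace_complement : subspace complement.
Proof.
split=> [e|x y Vx Vy e|c x Vx e].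
- by rewrite raddf0; exact: bspan0.
- by rewrite raddfD; exact: bspanD.
- by rewrite linearZ; exact: bspanZ.
Qed.

Lemma graded_complement : graded_subspace complement.
Proof.
split; first exact: subspace_complement.
by move=> f d Vf; exact: bspan_complement (Vf d).
Qed.

(** Both halves go degree by degree: since [J] is graded, each component of a difference lying in
    [J] is killed by [bspan_coinv0], and [homog_bspan] reduces each component of [z]. *)
Lemma bij_mod_complement : bij_mod complement J.
Proof.
have [V0 VD VZ] := subspace_complement.
split=> [x y Vx Vy Jxy|z].
  apply/eqP; rewrite -subr_eq0; apply/eqP; set d := x - y.
  rewrite [d](@pihomog_partitionE _ _ mdeg (msize d)) // big1 // => e _.
  apply: (@bspan_coinv0 e); last exact: coinv_graded.
  by rewrite raddfB /= -scaleN1r; apply: bspanD => //; exact: bspanZ.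
rewrite [z](@pihomog_partitionE _ _ mdeg (msize z)) //.
apply: (big_ind (fun z => exists2 x, complement x & J (z - x))).
- by exists 0 => //; rewrite subrr; exact: ideal_gen0.
- move=> x y [x' Vx' Jx'] [y' Vy' Jy']; exists (x' + y'); first exact: VD.
  by rewrite opprD addrACA; exact: ideal_genD.
move=> e _; have [v ve Jv] := homog_bspan (pihomogP mdeg e z).
by exists v => //; exact: bspan_complement ve.
Qed.

(** * Expansions in products of power sums *)

Section Expansion.
Variable t : nat.
Local Notation E := {mpoly {mpoly F[k * m]}[k * t]}.
Local Notation Rn := {mpoly F[k * (m + t)]}.
Local Notation Jn := (@coinv_ideal F k (m + t)).
Local Notation q := (@lpow F k m t).
Local Notation join := (@joinp F k m t).
Local Notation term := (seq (k.-tuplelexi nat) * 'X_{1..k * t} * R)%type.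

(* (s, mu, v) stands for v x^mu (\prod_(a in s) q a), v a form in the span of the
   chosen representatives of the coinvariants for m. *)
Definition term_val (x : term) : E :=
  x.2%:MP * 'X_[x.1.2] * \prod_(a <- x.1.1) q a.

(** Here [j] is the total degree. The sequence may be unsorted; [expansion_free] sorts it. *)
Definition term_ok j (x : term) : Prop :=
  (forall a, a \in x.1.1 -> a <> [tuple 0%N | _ < k]) /\
  exists2 e, bspan e x.2 & (e + mdeg x.1.2 + seqweight x.1.1)%N = j.

(** [r] bounds the number of factors [q a] from below; [r = 1] records that every term lies in the
    ideal generated by the [q a], which [joinp] sends into [Jn]. *)
Definition expands r j (g : E) : Prop :=
  exists2 l : seq term, forall x, x \in l -> term_ok j x /\ (r <= size x.1.1)%N
                      & g = \sum_(x <- l) term_val x.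

Lemma expands0 r j : expands r j 0.
Proof. by exists [::] => //; rewrite big_nil. Qed.

Lemma expandsD r j g h : expands r j g -> expands r j h -> expands r j (g + h).
Proof.
move=> [l lP ->] [l' lP' ->]; exists (l ++ l'); last by rewrite big_cat.
by move=> x; rewrite mem_cat => /orP[/lP|/lP'].
Qed.

Lemma expandsM r j a g : a <> [tuple 0%N | _ < k] ->
  expands r j g -> expands r.+1 (j + vweight a) (g * q a).
Proof.
move=> a0 [l lP ->]; exists [seq (a :: x.1.1, x.1.2, x.2) | x <- l].
  move=> _ /mapP [x /lP [[x0 [e xe <-]] rx] ->]; split=> //; split=> /=.
    by move=> c; rewrite inE => /predU1P [->|/x0].
  by exists e => //; rewrite /seqweight big_cons [(vweight a + _)%N]addnC !addnA.
rewrite big_map mulr_suml; apply: eq_bigr => x _.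
by rewrite /term_val /= big_cons [RHS]mulrCA mulrC.
Qed.

Lemma expands_bspan e mu v : bspan e v -> expands 0 (e + mdeg mu) (v%:MP * 'X_[mu]).
Proof.
move=> ve; exists [:: ([::], mu, v)]; last first.
  by rewrite big_seq1 /term_val big_nil mulr1.
move=> x; rewrite inE => /eqP ->; split=> //; split=> //.
by exists e => //=; rewrite /seqweight big_nil addn0.
Qed.

(** Induction on [e]: modulo [J], [c] lies in the span of the representatives, and the remainder is
    a sum of [r * powersum F m a]. Trading each power sum for [q a] leaves coefficients of degree
    [e - vweight a], the lost weight moving to [q a] or to the last columns. *)
Lemma expands_homog e mu c :
  c \is e.-homog -> expands 0 (e + mdeg mu) (c%:MP * 'X_[mu]).
Proof.
elim/ltn_ind: e mu c => e IHe mu c ce.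
have [v ve Jcv] := homog_bspan ce.
have vh := bspan_homog ve.
have [l lP] := coinv_pihomog char0 e Jcv.
rewrite pihomog_dE ?rpredB // => /(canRL (subrK _)) ->.
rewrite rmorphD /= mulrDl; apply: expandsD; last exact: expands_bspan.
rewrite raddf_sum mulr_suml big_seq.
apply: (big_ind (expands 0 (e + mdeg mu))) => [|x y|[r a] xl].
- exact: expands0.
- exact: expandsD.
have /= [a0 ae rh] := lP _ xl.
have a_gt0 := vweight_gt0 a0.
have lt_e : (e - vweight a < e)%N by rewrite ltn_subrL a_gt0 (leq_trans a_gt0).
(* p_(a,m) = q_a - (the power sum of the last t columns) *)
have -> : (r * powersum F m a)%:MP * 'X_[mu] =
    r%:MP * 'X_[mu] * q a + \sum_j (- r)%:MP * 'X_[mu + rmono a j].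
  rewrite /lpow mulrDr -addrA mpolyCM mulrAC -[LHS]addr0; congr (_ + _); apply: esym.
  rewrite mulr_sumr -big_split big1 // => j _ /=.
  by rewrite mpolyXD mpolyCN [X in _ + X]mulrA !mulNr addrN.
apply: expandsD.
  have := expandsM a0 (IHe _ lt_e mu r rh).
  by rewrite addnAC subnK // => -[l' l'P ->]; exists l' => // x /l'P [].
apply: (big_ind (expands 0 (e + mdeg mu))) => [|x y|j _].
- exact: expands0.
- exact: expandsD.
have := IHe _ lt_e (mu + rmono a j)%MM (- r).
rewrite mdegD mdeg_rmono addnA addnAC subnK //; apply.
by rewrite rpredN.
Qed.

Lemma homog_joinp j f :
  f \is j.-homog -> exists2 g, expands 0 j g & f = join g.
Proof.
move=> /dhomogP fj; rewrite [f]mpolyE big_seq.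
apply: (big_ind (fun f => exists2 g, expands 0 j g & f = join g)).
- by exists 0; [exact: expands0|rewrite rmorph0].
- move=> x y [g gj ->] [h hj ->]; exists (g + h); first exact: expandsD.
  by rewrite rmorphD.
move=> M /fj /= <-; have [c [mu [-> ->]]] := @mpolyX_joinp F k m t M.
exists ((f@_M *: 'X_[c])%:MP * 'X_[mu]).
  by apply: expands_homog; rewrite rpredZ // dhomogX.
by rewrite joinpZ.
Qed.

(** Each cofactor of a power sum is expanded by [homog_joinp], and the power sum itself supplies the
    additional factor [q a]. *)
Lemma coinv_joinp j f : f \is j.-homog -> Jn f ->
  exists2 g, expands 1 j g & f = join g.
Proof.
move=> fj Jf; have [l lP] := coinv_pihomog char0 j Jf.
rewrite pihomog_dE // => ->; rewrite big_seq.
apply: (big_ind (fun f => exists2 g, expands 1 j g & f = join g)).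
- by exists 0; [exact: expands0|rewrite rmorph0].
- move=> x y [g gj ->] [h hj ->]; exists (g + h); first exact: expandsD.
  by rewrite rmorphD.
move=> [r a] /lP /= [a0 aj /homog_joinp [g gj ->]]; exists (g * q a).
  by rewrite -(subnK aj); exact: expandsM.
by rewrite rmorphM /= joinp_lpow.
Qed.

Lemma dhomog_msize_le e (v : R) : v \is e.-homog -> (msize v <= e.+1)%N.
Proof.
move=> /dhomogP ve; rewrite mmeasureE big_seq; apply/bigmax_leqP_seq => M Mv _.
by move: (ve _ Mv) => /= ->.
Qed.

Lemma seqweight_sort (s : seq (k.-tuplelexi nat)) :
  seqweight (sort <=%O s) = seqweight s.
Proof. by apply: perm_big; rewrite perm_sort. Qed.

(** Collecting terms with the same sorted sequence gives coefficients [W s] to which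
    [quasifree_lift] applies; the terms without factors form [W [::]]. *)
Lemma expansion_free j (l : seq term) : quasifree F k m -> (j <= m)%N ->
  (forall x, x \in l -> term_ok j x) -> \sum_(x <- l) term_val x = 0 ->
  \sum_(x <- l | x.1.1 == [::]) x.2%:MP * 'X_[x.1.2] = 0.
Proof.
move=> qf jm lP l0.
pose W s : E := \sum_(x <- l | sort <=%O x.1.1 == s) x.2%:MP * 'X_[x.1.2].
have adm_sort x : x \in l -> admissible m (sort <=%O x.1.1).
  case/lP => x0 [e _ ej]; split.
  - exact: sort_le_sorted.
  - by move=> a; rewrite mem_sort => /x0.
  - by rewrite seqweight_sort (leq_trans _ jm) // -ej leq_addl.
suff W0 : W [::] = 0.
  rewrite -[RHS]W0; apply: eq_bigl => x.
  by rewrite -!size_eq0 size_sort.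
have [V0 VD VZ] := subspace_complement.
apply: (quasifree_lift qf graded_complement bij_mod_complement (W := W)).
- move=> s mu _; rewrite /W big_seq_cond.
  apply: (big_ind (fun g : E => complement g@_mu /\
    (msize g@_mu <= (m - seqweight s).+1)%N)).
  + by rewrite mcoeff0 mmeasure0.
  + move=> x y [Vx xs] [Vy ys]; rewrite mcoeffD; split; first exact: VD.
    by rewrite (leq_trans (msizeD_le _ _)) // geq_max xs.
  move=> x /andP [/lP [_ [e xe ej]] /eqP <-]; rewrite seqweight_sort.
  rewrite mcoeffCM mcoeffX; case: eqP => _; rewrite (mulr1, mulr0); last first.
    by rewrite mmeasure0.
  split; first exact: bspan_complement xe.
  (* The bound required by the conjecture holds because [e], the degree in the last columns and the
     weight of [s] add up to [j <= m]. *)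
  rewrite (leq_trans (dhomog_msize_le (bspan_homog xe))) // ltnS leq_subRL.
    by rewrite (leq_trans _ jm) // -ej addnC leq_add2r leq_addr.
  by rewrite (leq_trans _ jm) // -ej leq_addl.
- have fA := finite_admissible k m.
  rewrite fsbig_finite //= -[RHS]l0.
  (* After exchanging the sums, each term of [l] meets exactly one [s], its own sorted sequence, and
     sorting does not change the product. *)
  under eq_bigr do rewrite /W mulr_suml big_mkcond /=.
  rewrite exchange_big big_seq [RHS]big_seq; apply: eq_bigr => x xl /=.
  rewrite -big_mkcond (eq_bigl (pred1 (sort <=%O x.1.1))); last first.
    by move=> s; exact: eq_sym.
  rewrite -big_filter filter_pred1_uniq; first last.
  + by rewrite in_fset_set // inE; exact: adm_sort.
  + exact: finmap.fset_uniq.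
  rewrite big_seq1 /term_val; congr (_ * _).
  by apply: perm_big; rewrite perm_sort.
- by split => //; rewrite /seqweight big_nil.
Qed.

(** * A basis of the coinvariants for [m + t] columns in degrees at most [m] *)

Local Notation index j :=
  {mu : 'X_{1..(k * t)%N < j.+1} & 'I_(hilb F k m (j - mdeg mu))}.

Definition cobasis_vec j (x : index j) : Rn :=
  join ((b (tagged x))%:MP * 'X_[tag x]).

Lemma subnK_index j (x : index j) : (j - mdeg (tag x) + mdeg (tag x))%N = j.
Proof. by rewrite subnK // -ltnS bmdeg. Qed.

Lemma cobasis_homog j x : @cobasis_vec j x \is j.-homog.
Proof.
rewrite -[in j.-homog](subnK_index x); apply: joinp_homog.
by have [bh _ _] := bP (j - mdeg (tag x)); exact: bh.
Qed.

(** A combination in [Jn] also has an expansion in which every term carries a factor [q a].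
    Subtracting the two yields a relation whose factor-free part is the combination, so it vanishes
    by [expansion_free]; freeness of [b] finishes at each [mu]. *)
Lemma cobasis_free j c : quasifree F k m -> (j <= m)%N ->
  Jn (\sum_x c x *: @cobasis_vec j x) -> forall x, c x = 0.
Proof.
move=> qf jm Jc.
pose w : E := \sum_(x : index j) (c x *: b (tagged x))%:MP * 'X_[tag x].
have w0 : w = 0.
  have fj : \sum_x c x *: @cobasis_vec j x \is j.-homog.
    by rewrite rpred_sum // => x _; rewrite rpredZ // cobasis_homog.
  have [g [l lP gE] wg] := coinv_joinp fj Jc.
  have {wg} wg : w = g.
    apply: (can_inj (@joinpK F k m t)); rewrite -wg rmorph_sum.
    by apply: eq_bigr => x _; rewrite joinpZ.
  (* The list [l0] represents [- w] by terms without factors. *)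
  pose l0 : seq term := [seq ([::], bmnm (tag x), - (c x *: b (tagged x))) |
    x <- index_enum (index j : finType)].
  have l0_ok x : x \in l0 -> term_ok j x.
    move=> /mapP [y _ ->]; split=> //; exists (j - mdeg (tag y))%N => /=.
      by rewrite -scaleNr; apply: bspanZ; exact: bspan_basis.
    by rewrite /seqweight big_nil addn0 subnK_index.
  have ok x : x \in l0 ++ l -> term_ok j x.
    by rewrite mem_cat => /orP[/l0_ok|/lP []].
  have val0 : \sum_(x <- l0 ++ l) term_val x = 0.
    rewrite big_cat /= -gE -wg big_map -big_split big1 // => x _.
    by rewrite /term_val /= big_nil mulr1 raddfN mulNr addNr.
  have val1 : \sum_(x <- l | x.1.1 == [::]) x.2%:MP * 'X_[x.1.2] = 0 :> E.
    rewrite big_seq_cond big1 // => x /andP[xl].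
    by case: (x.1.1) (lP _ xl) => // -[].
  have := expansion_free qf jm ok val0.
  rewrite big_cat /= val1 addr0 big_map /=.
  move=> /(congr1 -%R); rewrite oppr0 -sumrN => <-.
  by apply: eq_bigr => x _; rewrite raddfN mulNr opprK.
case=> mu i; have [_ free _] := bP (j - mdeg mu).
move: i; apply: (free (fun i => c (Tagged _ i))).
suff -> : \sum_i c (Tagged (fun mu : 'X_{1..(k * t)%N < j.+1} =>
    'I_(hilb F k m (j - mdeg mu))) i) *: b (e := j - mdeg mu) i = w@_mu.
  by rewrite w0 mcoeff0; exact: ideal_gen0.
(* The type of [i] depends on [nu], so [nu = mu] is first imposed by a Kronecker delta. *)
have -> : w@_mu = \sum_(nu : 'X_{1..(k * t)%N < j.+1})
    \sum_i (mu == nu)%:R *: (c (Tagged (fun mu : 'X_{1..(k * t)%N < j.+1} =>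
    'I_(hilb F k m (j - mdeg mu))) i) *: b (e := j - mdeg nu) i).
  rewrite sig_big_dep raddf_sum; apply: eq_bigr => -[nu i] _ /=.
  rewrite mcoeffCM mcoeffX eq_sym -bmeqP.
  by case: eqP; rewrite ?(mulr1, mulr0, scale1r, scale0r).
rewrite (bigD1 mu) //=.
rewrite [X in _ + X]big1 ?addr0 => [|nu /negPf ne]; last first.
  by rewrite big1 // => i _; rewrite eq_sym ne scale0r.
by apply: eq_bigr => i _; rewrite eqxx scale1r.
Qed.

(** In an expansion of [f], terms with a factor [q a] fall into [Jn] and the others are combinations
    of cobasis vectors. This works in every degree; [j <= m] enters only through freeness. *)
Lemma cobasis_gen j f : f \is j.-homog ->
  exists c, Jn (f - \sum_x c x *: @cobasis_vec j x).
Proof.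
move=> /homog_joinp [_ [l lP ->] ->]; rewrite rmorph_sum big_seq.
have PD f1 f2 : (exists c, Jn (f1 - \sum_x c x *: @cobasis_vec j x)) ->
    (exists c, Jn (f2 - \sum_x c x *: @cobasis_vec j x)) ->
    exists c, Jn (f1 + f2 - \sum_x c x *: @cobasis_vec j x).
  move=> [c1 J1] [c2 J2]; exists (fun x => c1 x + c2 x).
  under eq_bigr do rewrite scalerDl.
  by rewrite big_split opprD addrACA; exact: ideal_genD.
have P0 f0 : Jn f0 -> exists c, Jn (f0 - \sum_x c x *: @cobasis_vec j x).
  move=> J0; exists (fun=> 0); rewrite big1 ?subr0 // => x _.
  by rewrite scale0r.
apply: (big_ind (fun f => exists c, Jn (f - \sum_x c x *: @cobasis_vec j x))).
- exact/P0/ideal_gen0.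
- exact: PD.
move=> [[s mu] v] /lP /= [[/= s0 [e ve ej]] _].
case: s s0 ej => [|a s] s0 ej; last first.
  apply: P0; rewrite /term_val /= big_cons mulrCA rmorphM mulrC /= joinp_lpow.
  by apply: ideal_genM; apply: powersum_coinv; apply: s0; rewrite mem_head.
rewrite /term_val /= big_nil mulr1; move: ej; rewrite /seqweight big_nil addn0 => ej.
have mu_lt : (mdeg mu < j.+1)%N by rewrite ltnS -ej leq_addl.
have {ej} ej : e = (j - mdeg (BMultinom mu_lt))%N by rewrite /= -ej addnK.
subst e; case: ve => d ->; rewrite raddf_sum mulr_suml rmorph_sum.
apply: (big_ind (fun f => exists c, Jn (f - \sum_x c x *: @cobasis_vec j x))).
- exact/P0/ideal_gen0.
- exact: PD.
move=> i _; pose y0 : index j := existT _ (BMultinom mu_lt) i.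
exists (fun y => d i * (y == y0)%:R).
rewrite (bigD1 y0) //= eqxx mulr1 big1 => [|y /negPf ->].
  by rewrite addr0 /cobasis_vec joinpZ subrr; exact: ideal_gen0.
by rewrite mulr0 scale0r.
Qed.
End Expansion.
End HomogeneousComplement.

(** * Dimension count and Hilbert series *)

Lemma dim_mod_card (F : fieldType) (M : lmodType F) (V W : set M)
    (T : finType) (v : T -> M) : subspace W -> (forall x, V (v x)) ->
  (forall c : T -> F, W (\sum_x c x *: v x) -> forall x, c x = 0) ->
  (forall y, V y -> exists c : T -> F, W (y - \sum_x c x *: v x)) ->
  dim_mod V W = #|T|.
Proof.
move=> sW vV vfree vgen; pose b (i : 'I_#|T|) := v (enum_val i).
have sumE (c : 'I_#|T| -> F) : \sum_i c i *: b i = \sum_x c (enum_rank x) *: v x.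
  rewrite (reindex _ (onW_bij _ (@enum_rank_bij T))).
  by apply: eq_bigr => x _; rewrite /b enum_rankK.
apply: (dim_modE sW (b := b)); split=> [i|c|y /vgen [c Wc]]; first exact: vV.
  by rewrite sumE => /vfree c0 i; rewrite -(enum_valK i); exact: c0.
exists (c \o enum_val); rewrite sumE.
by under eq_bigr do rewrite /= enum_rankK.
Qed.

Lemma hilb_split (F : fieldType) (k m t j : nat) :
  [pchar F] =i pred0 -> quasifree F k m -> (j <= m)%N ->
  hilb F k (m + t) j =
  (\sum_(mu : 'X_{1..(k * t)%N < j.+1}) hilb F k m (j - mdeg mu))%N.
Proof.
move=> char0 qf jm; pose b e := projT1 (cid (hilbP F k m e)).
have bP e := projT2 (cid (hilbP F k m e)).
rewrite /hilb (dim_mod_card (T := {mu : 'X_{1..(k * t)%N < j.+1} &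
  'I_(hilb F k m (j - mdeg mu))}) (v := @cobasis_vec F k m b t j)).
- rewrite card_tagged sumnE big_map big_enum.
  by apply: eq_bigr => mu _; rewrite card_ord.
- exact: subspace_ideal_gen.
- by move=> x; exact: cobasis_homog.
- by move=> c; exact: cobasis_free.
- by move=> y; exact: cobasis_gen.
Qed.

(** Counts the monomials of degree [d] in [N] variables. [N = 0] is separate because the binomial
    with truncated [N - 1] would give 1 in every degree. *)
Definition nb_monomials (N d : nat) : nat :=
  if N is N'.+1 then 'C(d + N', d) else (d == 0)%N.

Lemma card_monomials N d j : (d <= j)%N ->
  #|[pred mu : 'X_{1..N < j.+1} | mdeg mu == d]| = nb_monomials N d.
Proof.
move=> dj; case: N => [|N].
  rewrite /nb_monomials; case: eqP => d0.
    rewrite -[RHS]/1%N -(card1 (bm0 : 'X_{1..0 < j.+1})); apply: eq_card => mu.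
    by rewrite !inE bmeqP nvar0_mnmE eqxx mdeg0 d0.
  by apply: eq_card0 => mu; rewrite !inE nvar0_mnmE mdeg0 eq_sym; apply/eqP.
rewrite /nb_monomials -size_basis cardE -(size_map (@bmnm N.+1 j.+1)).
apply/perm_size/uniq_perm.
- by rewrite map_inj_uniq ?enum_uniq //; exact: val_inj.
- exact: uniq_basis.
move=> mu; rewrite -basis_cover; apply/mapP/idP => [[nu]|mud].
  by rewrite mem_enum inE => nud ->.
have mu_lt : (mdeg mu < j.+1)%N by rewrite ltnS (eqP mud).
by exists (BMultinom mu_lt); rewrite ?mem_enum ?inE.
Qed.

(** In degree [d] the two product equations agree in all lower coefficients by induction, and the
    unit [u 0] cancels. *)
Lemma ps_inv_uniq (A : unitRingType) (u w : nat -> A) :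
  u 0%N \is a GRing.unit -> ps_mul u w =1 (fun d => (d == 0%N)%:R) ->
  ps_inv u =1 w.
Proof.
move=> u0 uw d; elim/ltn_ind: d => d IHd.
have := ps_mul_inv u0 d; rewrite -(uw d) /ps_mul !big_ord_recl !subn0.
rewrite (eq_bigr (fun i : 'I_d => u (lift ord0 i) * w (d - lift ord0 i)%N)).
  by move/addIr/(mulrI u0).
by move=> i _; rewrite IHd // ltn_subrL (leq_trans _ (ltn_ord i)).
Qed.

(** By Pascal's rule, one factor [1 - 'X] turns the counts for [N.+1] variables into those for
    [N]. *)
Lemma ps_mul_monomials N :
  ps_mul (ps_of_poly ((1 - 'X) ^+ N : {poly int})) (fun d => (nb_monomials N d)%:Z)
  =1 (fun d => (d == 0%N)%:R).
Proof.
elim: N => [|N IHN] d.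
  rewrite /ps_mul /ps_of_poly expr0 (bigD1 ord0) //= subn0 coef1 mul1r big1 ?addr0.
    by case: d.
  by move=> i /negPf; rewrite coef1 -val_eqE /= => ->; rewrite mul0r.
rewrite -IHN.
(* A convolution up to degree [d] is a coefficient of a product of polynomials, which makes
   associativity available. *)
have coefE M p : ps_mul (ps_of_poly p) (fun d => (nb_monomials M d)%:Z) d =
    (p * \poly_(i < d.+1) (nb_monomials M i)%:Z)`_d.
  rewrite coefM; apply: eq_bigr => i _; rewrite coef_poly.
  by rewrite ltnS leq_subr.
rewrite !coefE exprSr -mulrA !coefM; apply: eq_bigr => i _; congr (_ * _).
move: (d - i)%N (leq_subr i d) => e ed.
rewrite mulrBl mul1r coefB coefXM !coef_poly !ltnS ed.
case: e ed => [|e] ed /=; first by rewrite subr0; case: (N) => //= ?; rewrite !bin0.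
rewrite ltnW //.
case: N {IHN coefE} => [|N] /=.
  by rewrite !addn0 !binn subrr.
by rewrite addnS binS PoszD -addSnnS addrK.
Qed.

Lemma ps_inv_monomials N :
  ps_inv (ps_of_poly ((1 - 'X) ^+ N : {poly int})) =1
  (fun d => (nb_monomials N d)%:Z).
Proof.
apply: ps_inv_uniq; last exact: ps_mul_monomials.
rewrite /ps_of_poly -horner_coef0 horner_exp hornerD hornerN hornerX hornerC.
by rewrite subr0 expr1n unitr1.
Qed.

Lemma hilb_series_split (F : fieldType) (k m t : nat) :
  [pchar F] =i pred0 -> quasifree F k m ->
  ps_trunc m (hilb_series F k (m + t)) =
  ps_trunc m (ps_mul (ps_inv (ps_of_poly ((1 - 'X) ^+ (k * t) : {poly int})))
                     (hilb_series F k m)).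
Proof.
move=> char0 qf; apply: eq_poly => j; rewrite ltnS => jm.
rewrite /hilb_series (hilb_split t char0 qf jm).
(* Grouping the [mu] by degree produces the convolution; [inord] loses nothing since
   [mdeg mu < j.+1]. *)
rewrite (partition_big
  (fun mu : 'X_{1..(k * t)%N < j.+1} => inord (mdeg mu) : 'I_j.+1) xpredT) //=.
rewrite (big_morph Posz PoszD (erefl _)); apply: eq_bigr => d _.
have mdegE (mu : 'X_{1..(k * t)%N < j.+1}) :
    (inord (mdeg mu) == d :> 'I_j.+1) = (mdeg mu == d).
  by rewrite -val_eqE /= inordK // bmdeg.
rewrite (eq_big [pred mu : 'X_{1..(k * t)%N < j.+1} | mdeg mu == d]
  (fun=> hilb F k m (j - d))) //; last first.
  by move=> mu; rewrite mdegE => /eqP ->.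
rewrite sum_nat_const card_monomials; last by rewrite -ltnS.
by rewrite ps_inv_monomials PoszM.
Qed.

Theorem theorem18 (R : realType) (k m : nat) (hk : (1 <= k)%N)
    (hm : (1 <= m)%N) (hQF : quasifree R[i] k m) (n : nat) (hn : (m <= n)%N) :
  ps_trunc m (hilb_series R[i] k n) =
  ps_trunc m (ps_mul (ps_inv (ps_of_poly ((1 - 'X) ^+ (k * (n - m)) : {poly int})))
                     (hilb_series R[i] k m)).
Proof.
have /= := @hilb_series_split R[i] k m (n - m) (@Num.Theory.pchar_num _) hQF.
by rewrite subnKC.
Qed.
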